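(* Let $G$ be a finite group of order $n$, let $S\subseteq G$, and let $\Gamma$ be one of the following graphs: (1) the Cayley graph $C(G,S)$, where $S$ is closed under conjugation by the elements of $G$ and $C(G,S)$ is undirected and connected; (2) the Cayley sum graph $C_\Sigma(G,S)$, where $S$ is symmetric and $C_\Sigma(G,S)$ is undirected and connected; (3) the twisted Cayley graph $C(G,S)^\sigma$, where $S$ is symmetric and closed under conjugation by the elements of $G$, $\sigma$ is an automorphism of $G$ of order two, and $C(G,S)^\sigma$ is undirected and connected; (4) the twisted Cayley sum graph $C_\Sigma(G,S)^\sigma$, where $S$ is symmetric, $\sigma$ is an automorphism of $G$ of order two, and $C_\Sigma(G,S)^\sigma$ is undirected and connected. Then the cop number of $\Gamma$ is at most $2\sqrt{n}\log n$. Consequently, for any real number $c<\frac12$, the cop numbers of these graphs are $O(n^{1-c})$. In particular, the weak Meyniel conjecture holds for these graphs.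
   Context: Here $\log$ is the natural logarithm. A subset $S$ of a group $G$ is symmetric if $S=S^{-1}$, where $S^{-1}=\{s^{-1}: s\in S\}$; it is closed under conjugation if $gsg^{-1}\in S$ for all $s\in S$, $g\in G$. All four graphs have vertex set $G$ (loops may occur). In the Cayley graph $C(G,S)$ there is an edge from $u$ to $v$ if $v=us$ for some $s\in S$. In the Cayley sum graph $C_\Sigma(G,S)$ there is an edge from $u$ to $v$ if $v=u^{-1}s$ for some $s\in S$. For an automorphism $\sigma$ of $G$, in the twisted Cayley graph $C(G,S)^\sigma$ there is an edge from $x$ to $y$ if $y=\sigma(xs)$ for some $s\in S$, and in the twisted Cayley sum graph $C_\Sigma(G,S)^\sigma$ there is an edge from $x$ to $y$ if $y=\sigma(x^{-1}s)$ for some $s\in S$. Such a graph is undirected if its edge relation is symmetric, i.e. whenever there is an edge from $x$ to $y$ there is also an edge from $y$ to $x$. The weak Meyniel conjecture states that, for a fixed constant $c>0$, the cop number of a connected graph on $n$ vertices is $O(n^{1-c})$. The game of cops and robbers on a finite connected graph is played as follows, with all positions visible to both sides. First, each of the cops chooses a vertex (several cops may occupy the same vertex); then the robber chooses a vertex. The cops and the robber then alternate turns, the cops going first; on a turn, players move along edges of the graph. In the cops' turn each cop may move along an edge or stay in place. It is assumed that the robber moves along some edge in each of its turns (a loop counts as an edge); the robber may not stay idle. The robber is captured when a cop and the robber occupy the same vertex. The cop number of the graph is the minimum number of cops required to capture the robber (after finitely many turns) no matter how the robber plays.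
   Formalization: The bound 2√n log n is stated only for n > 1, since for n = 1 it equals 0 while one cop is needed; a robber with no edge available (only in the loopless one-vertex graph) stays in place. *)

(* Defs.v *)
From HB Require Import structures.
From mathcomp Require Import all_boot all_order all_algebra all_fingroup.
From mathcomp Require Import all_classical all_reals all_analysis.

Set Implicit Arguments.
Unset Strict Implicit.
Unset Printing Implicit Defensive.

Import Order.TTheory GRing.Theory Num.Theory.
Local Open Scope ring_scope.

Definition connected_graph (T : finType) (e : rel T) : Prop :=
  forall x y : T, connect e x y.

Definition cop_move (T : finType) (e : rel T) : rel T :=
  fun x y => (y == x) || e x y.

(** The robber must move along an edge.  A robber standing on a vertex without
    any edge has no such move, and only then it stays where it is; in a connected
    graph this happens only for the loopless one-vertex graph, whose cop number
    is thus 1 rather than 0. *)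
Definition robber_move (T : finType) (e : rel T) : rel T :=
  fun x y => e x y || (y == x) && [forall z, ~~ e x z].

(** A strategy for [k] cops maps the sequence [[:: r_0; ...; r_(t-1)]] of the
    robber's positions seen so far to the positions of the cops after their
    [t]-th turn; the value at [[::]] is the initial placement. *)
Definition cop_strategy (T : finType) (k : nat) := seq T -> 'I_k -> T.

Definition legal_strategy (T : finType) (e : rel T) (k : nat)
    (f : cop_strategy T k) : Prop :=
  forall (h : seq T) (x : T) (i : 'I_k), cop_move e (f h i) (f (rcons h x) i).

Definition robber_play (T : finType) (e : rel T) (r : nat -> T) : Prop :=
  forall t : nat, robber_move e (r t) (r t.+1).

(** The robber reaches [r t] when the cops are at [f (mkseq r t)], and the cops
    answer by moving to [f (mkseq r t.+1)]; a capture occurs at either moment. *)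
Definition captures (T : finType) (k : nat) (f : cop_strategy T k)
    (r : nat -> T) : Prop :=
  exists (t : nat) (i : 'I_k),
    f (mkseq r t) i = r t \/ f (mkseq r t.+1) i = r t.

Definition cops_win (T : finType) (e : rel T) (k : nat) : Prop :=
  exists f : cop_strategy T k,
    legal_strategy e f /\ forall r, robber_play e r -> captures f r.

Lemma cops_win_ex (T : finType) (e : rel T) : exists k, `[< cops_win e k >].
Proof.
exists #|T|; apply/asboolP; exists (fun _ i => enum_val i); split.
  by move=> h x i; rewrite /cop_move eqxx.
by move=> r _; exists 0%N, (enum_rank (r 0%N)); left; rewrite enum_rankK.
Qed.

Definition cop_number (T : finType) (e : rel T) : nat :=
  ex_minn (cops_win_ex e).

Section CayleyGraphs.
Variable gT : finGroupType.
Implicit Types (S : {set gT}) (sigma : {perm gT}).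
Local Open Scope group_scope.

Definition symmetric_set S : Prop := S = S^-1.

Definition conj_closed S : Prop :=
  forall s g : gT, s \in S -> g * s * g^-1 \in S.

Definition cayley S : rel gT :=
  fun u v => [exists s in S, v == u * s].

Definition cayley_sum S : rel gT :=
  fun u v => [exists s in S, v == u^-1 * s].

Definition twisted_cayley sigma S : rel gT :=
  fun x y => [exists s in S, y == sigma (x * s)].

Definition twisted_cayley_sum sigma S : rel gT :=
  fun x y => [exists s in S, y == sigma (x^-1 * s)].

Definition automorphism_of_order_two sigma : Prop :=
  sigma \in Aut [set: gT] /\ #[sigma] = 2%N.

Definition undirected_connected (e : rel gT) : Prop :=
  symmetric e /\ connected_graph e.

Variant admissible_graph S : rel gT -> Prop :=
  | AdmissibleCayley of
      conj_closed S & undirected_connected (cayley S) :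
      admissible_graph S (cayley S)
  | AdmissibleCayleySum of
      symmetric_set S & undirected_connected (cayley_sum S) :
      admissible_graph S (cayley_sum S)
  | AdmissibleTwistedCayley sigma of
      symmetric_set S & conj_closed S & automorphism_of_order_two sigma
      & undirected_connected (twisted_cayley sigma S) :
      admissible_graph S (twisted_cayley sigma S)
  | AdmissibleTwistedCayleySum sigma of
      symmetric_set S & automorphism_of_order_two sigma
      & undirected_connected (twisted_cayley_sum sigma S) :
      admissible_graph S (twisted_cayley_sum sigma S).

End CayleyGraphs.

Definition graph_family := forall gT : finGroupType, rel gT -> Prop.

Definition admissible_family : graph_family :=
  fun gT Gamma => exists S : {set gT}, admissible_graph S Gamma.

(** For graphs on [n] vertices, the bound [O(n `^ a)] for [n] going to infinity is
    the same as a bound for all [n], as cop numbers are at most [n]. *)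
Definition cop_number_bigO (R : realType) (F : graph_family) (a : R) : Prop :=
  exists C : R, forall (gT : finGroupType) (Gamma : rel gT),
    F gT Gamma -> (cop_number Gamma)%:R <= C * #|gT|%:R `^ a.

Definition weak_meyniel (R : realType) (F : graph_family) : Prop :=
  exists2 c : R, 0 < c & cop_number_bigO F (1 - c).

(* Main.v *)
Require Import Defs.
From mathcomp Require Import all_boot all_order all_algebra all_fingroup.
From mathcomp Require Import all_classical all_reals all_analysis.
From mathcomp Require Import zify ring lra.

Set Implicit Arguments.
Unset Strict Implicit.
Unset Printing Implicit Defensive.

Import Order.TTheory GRing.Theory Num.Theory.
Local Open Scope ring_scope.

(** All four graphs have the form [x -> phi(x) S] with [S] symmetric and closed
    under conjugation and [phi] an involution (or the identity) that preserves
    the edges of the Cayley graph of [S]; that [S] is closed under conjugation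
    in the sum graphs, and stable under [sigma] in the twisted ones, follows
    from undirectedness.  If [|S| > sqrt n], a greedily chosen set of
    [sqrt n * log n + 1] vertices dominates the graph, and the cops catch the
    robber at once.  Otherwise [2 |S|] cops suffice.  After applying [phi^t] to
    the positions at time [t], every move is a right multiplication by an element
    of [S], and closure under conjugation lets a cop keep its difference
    [d = c^-1 r] with the robber.  For each [s] in [S] one cop instead replaces
    [d] by [d t^-1 s], with [t] in [S] of its choice, whenever the robber plays
    [s]; the robber has to move, so some [s] is played often enough for [d] to
    reach 1.  This needs [d] to start in the subgroup generated by the [t^-1 s];
    since that subgroup has index at most two, two starting positions cover all
    cases. *)

(** * Winning by domination and by causal strategies *)

Lemma cop_number_le (T : finType) (e : rel T) (k : nat) :
  cops_win e k -> (cop_number e <= k)%N.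
Proof.
by rewrite /cop_number; case: ex_minnP => m _ min_m win; apply/min_m/asboolP.
Qed.

Lemma cop_number_le_card (T : finType) (e : rel T) :
  (cop_number e <= #|T|)%N.
Proof.
apply: cop_number_le; exists (fun _ i => enum_val i); split.
  by move=> h x i; rewrite /cop_move eqxx.
by move=> r _; exists 0%N, (enum_rank (r 0%N)); left; rewrite enum_rankK.
Qed.

Lemma dominating_cops_win (T : finType) (e : rel T) (k : nat)
    (D : 'I_k -> T) :
  (forall v, exists i, cop_move e (D i) v) -> cops_win e k.
Proof.
move=> domD.
pose f (h : seq T) i :=
  if h is x :: _ then (if cop_move e (D i) x then x else D i) else D i.
exists f; split=> [[|y h] x i|r _] /=; last first.
- have [i Di] := domD (r 0%N); exists 0%N, i; right.
  by rewrite /f /= Di.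
- by rewrite /cop_move eqxx.
- by case: ifP => // _; rewrite /cop_move eqxx.
Qed.

(** A strategy may be given as a causal function of the whole play, legal along
    actual plays only: on the other histories a cop whose prescribed move is
    illegal stays in place. *)
Lemma causal_cops_win (T : finType) (e : rel T) (I : finType) (x0 : T)
    (c0 : I -> T) (pos : (nat -> T) -> nat -> I -> T) :
  (forall r r' t i, (forall j, (j <= t)%N -> r j = r' j) ->
     pos r t i = pos r' t i) ->
  (forall r, robber_play e r ->
     [/\ forall i, cop_move e (c0 i) (pos r 0%N i),
         forall t i, cop_move e (pos r t i) (pos r t.+1 i)
       & exists t i, pos r t i = r t]) ->
  cops_win e #|I|.
Proof.
move=> causal legal.
(* A history of length t+1 ends with the robber's position at time t, hence the predecessor; [x0]
   only fills later times, which [pos] ignores by causality. *)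
pose raw (h : seq T) i := pos (nth x0 h) (size h).-1 i.
pose fix rep (l : seq T) (i : I) {struct l} : T := if l is x :: l' then
  (if cop_move e (rep l' i) (raw (rev l) i) then raw (rev l) i else rep l' i)
  else c0 i.
exists (fun h i => rep (rev h) (enum_val i)); split.
  move=> h x i; rewrite rev_rcons /=.
  by case: ifP => // _; rewrite /cop_move eqxx.
move=> r play; have [init move [t [i capt]]] := legal r play.
have rawE n j : raw (mkseq r n.+1) j = pos r n j.
  rewrite /raw size_mkseq /=; apply: causal => m le_mn.
  by rewrite nth_mkseq.
have repS n j : rep (rev (mkseq r n.+1)) j = pos r n j.
  elim: n => [|n IHn].
    by rewrite -rawE /= -[[:: r 0%N]]/(mkseq r 1) /rev /= -/(mkseq r 1) rawE init.
  rewrite mkseqS rev_rcons /= IHn -rev_rcons -mkseqS revK rawE.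
  by rewrite move.
exists t, (enum_rank i); right.
by rewrite enum_rankK repS.
Qed.

(** By averaging, some vertex dominates at least a fraction d/|T| of the vertices not yet dominated,
    so each choice multiplies their number by at most 1 - d/|T|; denominators are cleared. *)
Lemma greedy_domination (T : finType) (e : rel T) (d k : nat) :
  (forall v, d <= #|[set x | e x v]|)%N -> (0 < #|T|)%N ->
  exists D : k.-tuple T,
    (#|[set v | ~~ has (e^~ v) D]| * #|T| ^ k <= #|T| * (#|T| - d) ^ k)%N.
Proof.
move=> degd n_gt0; elim: k => [|k [D leD]].
  by exists [tuple]; rewrite !expn0 !muln1 max_card.
set U := [set v | _] in leD.
pose N x := [set v in U | e x v].
(* Double counting of the edges that end in [U]. *)
have sumN : (d * #|U| <= \sum_x #|N x|)%N.
  have -> : (\sum_x #|N x| = \sum_(v in U) #|[set x | e x v]|)%N.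
    under eq_bigr do rewrite -sum1_card big_mkcond.
    rewrite exchange_big /= [RHS]big_mkcond; apply: eq_bigr => v _.
    case: ifP => vU; last by rewrite big1 // => x _; rewrite inE vU.
    rewrite -sum1_card [RHS]big_mkcond; apply: eq_bigr => x _.
    by rewrite !inE; rewrite inE in vU; rewrite vU.
  rewrite mulnC -sum_nat_const; exact: leq_sum.
have [x Nx] : exists x, (d * #|U| <= #|T| * #|N x|)%N.
  apply/existsP; rewrite -[X in is_true X]negbK negb_exists.
  apply/negP=> /forallP small.
  have : (\sum_x #|T| * #|N x| < \sum_(x : T) d * #|U|)%N.
    have [x0 _] := card_gt0P n_gt0.
    rewrite (bigD1 x0) //= [X in (_ < X)%N](bigD1 x0) //= -addSn leq_add //.
      by rewrite ltnNge small.
    by apply: leq_sum => x _; rewrite ltnW // ltnNge small.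
  by rewrite -big_distrr sum_nat_const /= ltn_pmul2l // ltnNge sumN.
exists [tuple of x :: D] => /=.
have -> : [set v | ~~ (e x v || has (e^~ v) D)] = U :\: N x.
  by apply/setP=> v; rewrite !inE; case: (has _ _); rewrite ?orbT ?orbF ?andbT.
have NU : N x \subset U by apply/fintype.subsetP=> v; rewrite inE => /andP[].
rewrite cardsDS // !expnS.
apply: (@leq_trans ((#|T| - d) * (#|U| * #|T| ^ k))%N); last first.
  by rewrite [X in (_ <= X)%N]mulnCA leq_mul2l leD orbT.
rewrite !mulnA leq_mul2r; apply/orP; right.
by rewrite mulnC mulnBr mulnBl leq_sub2l.
Qed.

(** * Graphs with edges from x to phi(x) S *)

Section InvolutionGraphs.
Variables (gT : finGroupType) (S : {set gT}) (phi : gT -> gT).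
Implicit Types x y z s u : gT.
Local Open Scope group_scope.

Definition involution_graph : rel gT := fun x y => (phi x)^-1 * y \in S.

Local Notation e := involution_graph.

Hypothesis S_inv : forall s, s \in S -> s^-1 \in S.
Hypothesis S_conj : conj_closed S.
Hypothesis phi1 : phi 1 = 1.
Hypothesis phiK : involutive phi.
Hypothesis phi_edge : forall x y, x^-1 * y \in S -> (phi x)^-1 * phi y \in S.
Hypothesis e_connected : connected_graph e.

Let S_conjV s x : s \in S -> x^-1 * s * x \in S.
Proof. by move=> /(@S_conj s x^-1); rewrite invgK. Qed.

(** As [phi] need not be a morphism, words are handled letter by letter: [phi_edge] shows that one
    more letter changes the image by a factor in [S]. *)
Let phi_gen x : x \in <<S>> -> phi x \in <<S>>.
Proof.
case/gen_prodgP=> n [c]; elim: n => [|n IHn] in x c * => Sc ->.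
  by rewrite big_ord0 phi1 group1.
rewrite big_ord_recr /=; set w := \prod_i _.
have Sw : phi w \in <<S>> by apply: IHn => // i; exact: Sc.
have := @phi_edge w (w * c ord_max); rewrite mulKg Sc => /(_ isT) Sw'.
by rewrite -[phi (_ * _)](mulKVg (phi w)) groupM // mem_gen.
Qed.

Lemma involution_graph_generates x : x \in <<S>>.
Proof.
have /connectP[p] := e_connected 1 x.
elim/last_ind: p x => [|p y IHp] x /=; first by move=> _ ->; exact: group1.
rewrite rcons_path last_rcons => /andP[ep ey] ->.
rewrite -(mulKVg (phi (last 1 p)) y) groupM //.
  by apply: phi_gen; exact: IHp ep erefl.
exact: mem_gen.
Qed.

(** Since S is closed under inverses, [phi] maps the in-neighbours of v bijectively onto v S. *)
Lemma involution_graph_indegree v : #|[set x | e x v]| = #|S|.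
Proof.
have phi_inj := inv_inj phiK.
rewrite -(card_imset _ phi_inj) -(card_imset S (mulgI v)).
apply: eq_card => x; apply/imsetP/imsetP=> [[y]|[s Ss ->]].
  rewrite inE /e => Sy ->; exists (((phi y)^-1 * v)^-1); first exact: S_inv.
  by rewrite invMg invgK mulKVg.
exists (phi (v * s)); last by rewrite phiK.
by rewrite inE /e phiK invMg -mulgA mulVg mulg1 S_inv.
Qed.

Lemma involution_graph_edges_nonempty : (1 < #|gT|)%N -> exists s, s \in S.
Proof.
move=> n_gt1; apply/set0Pn/negP=> /eqP S0.
have sub : [set: gT] \subset [1 gT].
  apply/fintype.subsetP=> x _; have := involution_graph_generates x.
  by rewrite S0 gen0.
by have := subset_leq_card sub; rewrite cards1 cardsT leqNgt n_gt1.
Qed.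

(** [delta j] is the difference [c^-1 * r] between a cop and the robber after
    [j] robber moves [s]. *)
Definition approach s (d : gT) (delta : nat -> gT) : Prop :=
  [/\ delta 0%N = d,
      forall j, delta j.+1 = delta j \/
        exists2 t, t \in S & delta j.+1 = delta j * t^-1 * s
    & d \in <<[set s^-1 * t | t in S]>> ->
        exists N, forall j, (N <= j)%N -> delta j = 1].

(** If d is a product of factors s^-1 t, multiplying by t^-1 s cancels the last one, so the factors
    are removed from the right until 1 is left. Otherwise [delta] is constant. *)
Lemma approach_exists s d : exists delta, approach s d delta.
Proof.
case: (boolP (d \in <<[set s^-1 * t | t in S]>>)) => [|dN]; last first.
  by exists (fun=> d); split=> // [j|]; [left | rewrite (negPf dN)].
case/gen_prodgP=> n [c]; elim: n => [|n IHn] in d c * => Sc.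
  rewrite big_ord0 => ->; exists (fun=> 1).
  by split=> // [j|_]; [left | exists 0%N].
rewrite big_ord_recr /=; set w := \prod_i _ => def_d.
have [delta [d0 dS dN]] : exists delta, approach s w delta.
  by apply: IHn; last reflexivity; move=> i; exact: Sc.
have w_gen : w \in <<[set s^-1 * t | t in S]>>.
  by apply: group_prod => i _; rewrite mem_gen.
exists (fun j => if j is j'.+1 then delta j' else d); split=> // [[|j] //|_].
  have /imsetP[t St def_c] := Sc ord_max.
  by right; exists t; rewrite // d0 def_d def_c !mulgA mulgK mulgKV.
have [N dN1] := dN w_gen; exists N.+1 => - [//|j]; exact: dN1.
Qed.

(** H is normal because S is closed under conjugation. Modulo H all elements of S equal s, and s^-1
    is in S, so s^2 is in H; each letter of a word in S thus switches between H and s H. *)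
Lemma difference_subgroup_index s x : s \in S ->
  let H := <<[set s^-1 * t | t in S]>> in x \in H \/ s^-1 * x \in H.
Proof.
move=> Ss H.
have genH t : t \in S -> s^-1 * t \in H.
  by move=> St; rewrite mem_gen // imset_f.
have genHJ t u : t \in S -> u^-1 * (s^-1 * t) * u \in H.
  move=> St.
  have -> : u^-1 * (s^-1 * t) * u
          = (s^-1 * (u^-1 * s * u))^-1 * (s^-1 * (u^-1 * t * u)).
    by rewrite !invMg !invgK !mulgA !mulgK.
  by rewrite groupM ?groupV ?genH ?S_conjV.
have HJ w u : w \in H -> u^-1 * w * u \in H.
  case/gen_prodgP=> n [c Sc ->].
  have -> : u^-1 * (\prod_(i < n) c i) * u = \prod_(i < n) (u^-1 * c i * u).
    elim: n {Sc} c => [|n IHn] c; first by rewrite !big_ord0 mulg1 mulVg.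
    by rewrite !big_ord_recr /= -IHn !mulgA mulgK.
  apply: group_prod => i _.
  by have /imsetP[t St ->] := Sc i; exact: genHJ.
have step w u : u \in S -> w \in H -> s^-1 * (w * u) \in H.
  move=> Su Hw.
  have -> : s^-1 * (w * u) = s^-1 * w * s * (s^-1 * u).
    by rewrite !mulgA mulgK.
  by rewrite groupM ?genH ?HJ.
have step' w u : u \in S -> s^-1 * w \in H -> w * u \in H.
  move=> Su Hw.
  have -> : w * u
      = (s^-1)^-1 * (s^-1 * u^-1)^-1 * s^-1 * (u^-1 * (s^-1 * w) * u).
    by rewrite invMg !invgK !mulgA !mulgK mulgV mul1g.
  by apply: groupM; apply: HJ => //; rewrite groupV genH ?S_inv.
case/gen_prodgP: (involution_graph_generates x) => n [c].
elim: n => [|n IHn] in x c * => Sc ->.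
  by left; rewrite big_ord0 group1.
rewrite big_ord_recr /=; set w := \prod_i _.
have [Hw|Hw] : w \in H \/ s^-1 * w \in H.
- by apply: (IHn _ (fun i => c (widen_ord (leqnSn n) i))) => // i.
- by right; exact: step.
- by left; exact: step'.
Qed.

Let iter_edge t x y :
  x^-1 * y \in S -> (iter t phi x)^-1 * iter t phi y \in S.
Proof. by elim: t => //= t IHt /IHt; exact: phi_edge. Qed.

Let iterK t x : iter t phi (iter t phi x) = x.
Proof. by elim: t => //= t IHt; rewrite -iterSr /= IHt phiK. Qed.

(** In the frame [R t = phi^t (r t)] all moves are right multiplications by
    elements of [S].  The cop [(s, b)] keeps its difference with the robber,
    except when the robber moves by [s], where it advances along [approach s]. *)
Lemma involution_graph_cops_win : (1 < #|gT|)%N -> cops_win e (2 * #|S|).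
Proof.
move=> /involution_graph_edges_nonempty[s0 Ss0].
pose I : finType := ({s | s \in S} * bool)%type.
(* Of the starts 1 and s, one has its difference with [r 0] in the subgroup needed by
   [approach s]. *)
pose c0 (i : I) := if i.2 then sval i.1 else 1.
have /choice[delta deltaP] (sd : gT * gT) : exists f, approach sd.1 sd.2 f.
  exact: approach_exists.
pose R (r : nat -> gT) t := iter t phi (r t).
pose K s (r : nat -> gT) t := (\sum_(j < t) (((R r j)^-1 * R r j.+1)%g == s))%N.
pose D (r : nat -> gT) t (i : I) :=
  delta (sval i.1, (c0 i)^-1 * r 0%N) (K (sval i.1) r t).
pose pos r t i := iter t phi (R r t * (D r t i)^-1).
have -> : (2 * #|S|)%N = #|I|.
  by rewrite card_prod card_bool card_sig mulnC; congr (_ * _)%N; apply: eq_card.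
apply: (@causal_cops_win _ e I 1 c0 pos) => [r r' t i eq_r | r play].
  rewrite /pos /D /R eq_r // eq_r //; congr (iter t phi (_ * (delta _ _)^-1)).
  apply: eq_bigr => j _; rewrite /R !eq_r //; exact: ltnW.
(* The robber is never stuck: [phi (r t) * s0] is always a neighbour. *)
have Rmove t : (R r t)^-1 * R r t.+1 \in S.
  have /orP[er | /andP[_ /forallP/(_ (phi (r t) * s0))]] := play t.
    have := iter_edge t.+1 er.
    by rewrite iterSr phiK.
  by rewrite /e mulKg Ss0.
split.
- move=> i; rewrite /pos /D /K /= big_ord0.
  have [-> _ _] := deltaP (sval i.1, (c0 i)^-1 * r 0%N).
  by rewrite /R /= invMg mulKVg invgK /cop_move eqxx.
- move=> t i; rewrite /cop_move; apply/orP; right.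
  rewrite /pos /e -iterS; apply: iter_edge.
  have [_ dS _] := deltaP (sval i.1, (c0 i)^-1 * r 0%N).
  rewrite /D /K big_ord_recr /= -/(K (sval i.1) r t).
  set f := delta _ in dS *; set k := K _ _ _; set u := (R r t)^-1 * _.
  (* In the frame, a cop whose difference goes from x to y moves by x u y^-1. This is x u x^-1 if y
     = x, and x v x^-1 if u = s and y = x v^-1 s. *)
  have -> x y : (R r t * x^-1)^-1 * (R r t.+1 * y^-1) = x * u * y^-1.
    by rewrite invMg invgK !mulgA.
  have Su : u \in S by exact: Rmove.
  clearbody u.
  case: eqVneq => [u_s|_]; last by rewrite addn0 S_conj.
  rewrite addn1; case: (dS k) => [->|[v Sv ->]]; first exact: S_conj.
  by rewrite -u_s !invMg invgK !mulgA mulgK S_conj.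
have /choice[N NP] s : exists N, s \in S -> exists i : I,
    sval i.1 = s /\ forall j, (N <= j)%N ->
    delta (s, (c0 i)^-1 * r 0%N) j = 1.
  case: (boolP (s \in S)) => [Ss|_]; last by exists 0%N.
  have [b Hb] : exists b : bool, (if b then s else 1)^-1 * r 0%N
      \in <<[set s^-1 * t | t in S]>>.
    have [H1|Hs] := difference_subgroup_index (r 0%N) Ss.
      by exists false; rewrite invg1 mul1g.
    by exists true.
  have [_ _ /(_ Hb)[N NP]] := deltaP (s, (if b then s else 1)^-1 * r 0%N).
  by exists N => _; exists (exist _ s Ss, b).
(* Pigeonhole: among the first t robber moves, some s occurs at least [N s] times. *)
pose t := (\sum_(s in S) N s)%N.
have sumK : (\sum_(s in S) K s r t)%N = t.
  rewrite exchange_big /= -[RHS]card_ord -sum1_card; apply: eq_bigr => j _.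
  rewrite (bigD1 _ (Rmove j)) /= eqxx big1 // => s /andP[_].
  by rewrite eq_sym => /negPf->.
have [s Ss le_NK] : exists2 s, s \in S & (N s <= K s r t)%N.
  apply/exists_inP; rewrite -[X in is_true X]negbK negb_exists_in.
  apply/negP=> /forall_inP small.
  have: (\sum_(s in S) K s r t < \sum_(s in S) N s)%N.
    rewrite (bigD1 s0) //= [X in (_ < X)%N](bigD1 s0) //= -addSn leq_add //.
      by rewrite ltnNge small.
    by apply: leq_sum => s /andP[Ss _]; rewrite ltnW // ltnNge small.
  by rewrite sumK ltnn.
have [i [def_s Ni]] := NP s Ss.
by exists t, i; rewrite /pos /D def_s Ni // invg1 mulg1 iterK.
Qed.

(** For n = 2 the bound is below 2, so a single cop has to do: connectedness puts the non-identity
    element in S, and a cop at 1 dominates. *)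
Lemma involution_graph_card2_cops_win : #|gT| = 2%N -> cops_win e 1.
Proof.
move=> n2; apply: (@dominating_cops_win _ _ _ (fun=> 1)) => v.
exists ord0; rewrite /cop_move; case: eqVneq => //= v_neq1.
rewrite /e phi1 invg1 mul1g; apply/negPn/negP=> vNS.
have /fintype.subsetP sub : <<S>> \subset [1 gT].
  rewrite gen_subG; apply/fintype.subsetP=> x Sx; rewrite inE.
  apply: contraTT isT => x_neq1.
  have : (#|[set 1%g; x; v]| <= #|gT|)%N by rewrite max_card.
  have x_neqv : x != v by apply: contraNneq vNS => <-.
  rewrite -finset.setUA cardsU1 cards2 !inE n2 x_neqv.
  by rewrite eq_sym (negPf x_neq1) eq_sym (negPf v_neq1).
by have := sub v (involution_graph_generates v); rewrite inE (negPf v_neq1).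
Qed.

End InvolutionGraphs.

(** * Logarithmic and exponential estimates *)

Section RealBounds.
Variable R : realType.

Lemma ln_ge1 (n : nat) : (2 < n)%N -> 1 <= ln n%:R :> R.
Proof.
move=> n_gt2.
have e_le : 1 <= ln (3 : R).
  (* ln (6/5) = - ln (1 - 1/6) is at least 1/6, and (6/5)^6 = 2.985984 is just below 3. *)
  have e6 : (6%:R : R)^-1 <= ln (6 / 5).
    rewrite -[6 / 5]invrK lnV ?posrE ?invr_gt0 //.
    have -> : (6 / 5 : R)^-1 = 1 + - 6^-1 by lra.
    have := @le_ln1Dx R (- 6^-1); rewrite lerNr; apply; lra.
  apply: (@le_trans _ _ (ln ((6 / 5 : R) ^+ 6))).
    rewrite lnXn; last by lra.
    by rewrite -[ln _ *+ _]mulr_natr -ler_pdivrMr ?mul1r.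
  by rewrite ler_ln ?posrE ?exprn_gt0 //; lra.
apply: le_trans e_le _; rewrite ler_ln ?posrE ?ltr0n //; last by lia.
by rewrite (ler_nat R 3).
Qed.

(** (1 - d/n)^k is at most exp(- k d / n), which is less than 1/n. *)
Lemma greedy_count_lt (n d k : nat) : (0 < n)%N -> (d <= n)%N ->
  n%:R * ln n%:R < k%:R * d%:R :> R -> (n * (n - d) ^ k < n ^ k)%N.
Proof.
move=> n_gt0 le_dn lt_kd; rewrite -(ltr_nat R) natrM !natrX natrB //.
have n0 : 0 < n%:R :> R by rewrite ltr0n.
have n_neq0 := lt0r_neq0 n0.
have le1 : n%:R - d%:R <= n%:R * expR (- (d%:R / n%:R)) :> R.
  have -> : n%:R - d%:R = n%:R * (1 + - (d%:R / n%:R)) :> R by field.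
  by rewrite ler_pM2l // expR_ge1Dx.
have lek : (n%:R - d%:R) ^+ k <= (n%:R * expR (- (d%:R / n%:R))) ^+ k :> R.
  by apply: lerXn2r; rewrite ?nnegrE ?subr_ge0 ?ler_nat // mulr_ge0 ?expR_ge0.
apply: (@le_lt_trans _ _ (n%:R * (n%:R * expR (- (d%:R / n%:R))) ^+ k)).
  by rewrite ler_pM2l.
rewrite exprMn mulrCA -[ltRHS]mulr1 ltr_pM2l ?exprn_gt0 //.
rewrite -expRM_natl -{1}(@lnK R n%:R) ?posrE // -expRD expR_lt1.
rewrite mulrN subr_lt0 mulrA ltr_pdivlMr //.
by rewrite mulrC.
Qed.

Lemma two_sqrt2_ln2_ge1 : 1 <= 2 * Num.sqrt 2 * ln 2 :> R.
Proof.
have ln2 : 2^-1 <= ln 2 :> R.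
  rewrite -[X in ln X]invrK lnV ?posrE ?invr_gt0 //.
  have -> : (2 : R)^-1 = 1 + - 2^-1 by lra.
  rewrite lerNr; apply: le_trans (le_ln1Dx _) _; lra.
have sqrt2 : 1 <= Num.sqrt 2 :> R by rewrite -[leLHS]sqrtr1 ler_sqrt; lra.
nra.
Qed.

(** With a = 1/2 - c, this is a ln n = ln (n^a) < n^a multiplied by 2 sqrt n / a. *)
Lemma sqrt_ln_le_powR (c : R) (n : nat) : c < 2^-1 -> (0 < n)%N ->
  2 * Num.sqrt n%:R * ln n%:R <= 2 / (2^-1 - c) * n%:R `^ (1 - c) :> R.
Proof.
move=> c_lt n_gt0; set a := 2^-1 - c.
have a_gt0 : 0 < a by rewrite subr_gt0.
have n0 : 0 < n%:R :> R by rewrite ltr0n.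
have -> : 1 - c = 2^-1 + a by rewrite /a; lra.
rewrite powRD; last by rewrite (gt_eqF n0) implybT.
rewrite -powR12_sqrt ?ler0n // mulrA [2 / a * _]mulrAC -[leRHS]mulrA.
rewrite ler_pM2l ?mulr_gt0 ?powR_gt0 //.
rewrite mulrC ler_pdivlMr // mulrC -ln_powR ltW // ln_sublinear //.
exact: powR_gt0.
Qed.

End RealBounds.

(** * The cop number bound, split at |S| = sqrt n *)

Lemma involution_graph_cop_number_le (R : realType) (gT : finGroupType)
    (S : {set gT}) (phi : gT -> gT) :
  (1 < #|gT|)%N ->
  (forall s, s \in S -> s^-1 \in S)%g -> conj_closed S ->
  phi 1%g = 1%g -> involutive phi ->
  (forall x y, x^-1 * y \in S -> (phi x)^-1 * phi y \in S)%g ->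
  connected_graph (involution_graph S phi) ->
  (cop_number (involution_graph S phi))%:R
    <= 2 * Num.sqrt #|gT|%:R * ln #|gT|%:R :> R.
Proof.
move=> n_gt1 S_inv S_conj phi1 phiK phi_edge conn; set e := involution_graph _ _.
have [n2|n_neq2] := eqVneq #|gT| 2%N.
  rewrite n2; apply: le_trans (two_sqrt2_ln2_ge1 R); rewrite (ler_nat R _ 1).
  exact/cop_number_le/involution_graph_card2_cops_win.
have n_gt2 : (2 < #|gT|)%N by rewrite ltn_neqAle eq_sym n_neq2.
have n_gt0 : (0 < #|gT|)%N by apply: ltn_trans n_gt1.
set n := #|gT| in n_gt0 n_gt1 n_gt2 *.
have lnn := ln_ge1 R n_gt2.
set q := Num.sqrt n%:R.
have q2 : q * q = n%:R by rewrite -expr2 sqr_sqrtr // ler0n.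
have q_ge1 : 1 <= q by rewrite -[leLHS]sqrtr1 ler_sqrt ?ler1n // ltr0n.
have [leSq|ltqS] := leP (#|S|%:R : R) q.
  apply: (@le_trans _ _ (2 * #|S|)%:R).
    by rewrite ler_nat; exact/cop_number_le/involution_graph_cops_win.
  rewrite natrM -mulrA ler_pM2l //; apply: le_trans leSq _.
  by rewrite ler_peMr // (le_trans _ q_ge1).
(* The extra 1 is absorbed by the factor 2 of the bound, as q ln n is at least 1. *)
set k := (Num.truncn (q * ln n%:R)).+1.
have qln_ge1 : 1 <= q * ln n%:R by rewrite -[leLHS]mulr1 ler_pM.
have k_gt : q * ln n%:R < k%:R by rewrite truncnS_gt.
have k_le : k%:R <= 2 * q * ln n%:R :> R.
  rewrite -mulrA mulr_natl mulr2n -natr1 lerD // truncn_le //.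
  exact: le_trans qln_ge1.
apply: le_trans k_le; rewrite ler_nat; apply: cop_number_le.
have [|//|D leD] := @greedy_domination gT e #|S| k.
  by move=> v; rewrite involution_graph_indegree.
have ltnk : (n * (n - #|S|) ^ k < n ^ k)%N.
  apply: (@greedy_count_lt R) => //; first exact: max_card.
  rewrite -{1}q2 -mulrA mulrC.
  apply: ltr_pM => //; first exact: le_trans qln_ge1.
  exact: le_trans q_ge1.
set U := [set v | _] in leD.
(* [leD] and [ltnk] give |U| n^k < n^k. *)
have U0 : #|U| = 0%N.
  apply/eqP; rewrite -leqn0 -ltnS -(ltn_pmul2r (m := n ^ k)) ?expn_gt0 ?n_gt0 //.
  by rewrite mul1n; exact: leq_ltn_trans ltnk.
apply: (@dominating_cops_win _ _ _ (tnth D)) => v.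
have : v \notin U by rewrite (cards0_eq U0) inE.
rewrite inE negbK => /hasP[x /tnthP[i ->] ev].
by exists i; rewrite /cop_move ev orbT.
Qed.

(** * Reduction of the four families to involution graphs *)

Section AdmissibleGraphs.
Variables (R : realType) (gT : finGroupType) (S : {set gT}).
Local Open Scope group_scope.

Hypothesis n_gt1 : (1 < #|gT|)%N.

Let bound : R := (2 * Num.sqrt #|gT|%:R * ln #|gT|%:R)%R.

Section Twisted.
Variable sigma : {perm gT}.
Hypotheses (As : sigma \in Aut [set: gT]) (sK : involutive sigma).
Hypothesis S_inv : forall s, s \in S -> s^-1 \in S.

Let sM (x y : gT) : sigma (x * y) = sigma x * sigma y.
Proof. by rewrite (morphicP (Aut_morphic As)) ?inE. Qed.

Let s1 : sigma 1 = 1.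
Proof. by apply: (mulgI (sigma 1)); rewrite -sM !mulg1. Qed.

Let sV (x : gT) : sigma x^-1 = (sigma x)^-1.
Proof. by apply: (mulgI (sigma x)); rewrite -sM !mulgV s1. Qed.

Lemma twisted_cayley_cop_number_le : conj_closed S ->
  undirected_connected (twisted_cayley sigma S) ->
  ((cop_number (twisted_cayley sigma S))%:R <= bound)%R.
Proof.
move=> S_conj [sym conn].
(* Reversing the edge from 1 to sigma(s) yields t in S with sigma(s) t = 1. *)
have Ssigma s : s \in S -> sigma s \in S.
  move=> Ss.
  have : twisted_cayley sigma S 1 (sigma s).
    by apply/exists_inP; exists s; rewrite // mul1g.
  rewrite sym => /exists_inP[t St /eqP/(congr1 sigma)].
  rewrite sK s1 => /esym/eqP; rewrite -eq_invg_mul => /eqP def_t.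
  by rewrite -[sigma s]invgK S_inv // def_t.
have eE : twisted_cayley sigma S = involution_graph S sigma.
  apply/funext => x; apply/funext => y; apply/exists_inP/idP.
    by case=> s Ss /eqP->; rewrite /involution_graph sM mulKg Ssigma.
  move=> Sy; exists (sigma ((sigma x)^-1 * y)); first exact: Ssigma.
  by rewrite sM sK mulKVg.
rewrite eE in conn *; apply: involution_graph_cop_number_le => //.
by move=> x y Sxy; rewrite -sV -sM Ssigma.
Qed.

Lemma twisted_cayley_sum_cop_number_le :
  undirected_connected (twisted_cayley_sum sigma S) ->
  ((cop_number (twisted_cayley_sum sigma S))%:R <= bound)%R.
Proof.
move=> [sym conn].
(* Reversing the edge from x^-1 to sigma(x s) yields t in S with sigma(t) = x s x^-1. *)
have SsigmaJ s x : s \in S -> sigma (x * s * x^-1) \in S.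
  move=> Ss.
  have : twisted_cayley_sum sigma S x^-1 (sigma (x * s)).
    by apply/exists_inP; exists s; rewrite // invgK.
  rewrite sym => /exists_inP[t St /eqP def_x].
  have -> : x^-1 = sigma (sigma (x * s))^-1 * sigma t by rewrite -sM.
  by rewrite sV sK mulKVg sK.
have Ssigma s : s \in S -> sigma s \in S.
  by move=> /(SsigmaJ s 1); rewrite mul1g invg1 mulg1.
have S_conj : conj_closed S.
  by move=> s x Ss; rewrite -[_ * _]sK Ssigma // SsigmaJ.
pose phi x := (sigma x)^-1.
have eE : twisted_cayley_sum sigma S = involution_graph S phi.
  apply/funext => x; apply/funext => y; apply/exists_inP/idP.
    by case=> s Ss /eqP->; rewrite /involution_graph /phi sM sV mulKg Ssigma.
  move=> Sy; exists (sigma ((phi x)^-1 * y)); first exact: Ssigma.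
  by rewrite sM sK sV mulKVg.
rewrite eE in conn *; apply: involution_graph_cop_number_le => //.
- by rewrite /phi s1 invg1.
- by move=> x; rewrite /phi sV invgK sK.
move=> x y Sxy; rewrite /phi invgK -sV -sM.
(* [phi] is an anti-automorphism, so x^-1 y must first be conjugated and inverted. *)
have -> : x * y^-1 = (x * (x^-1 * y) * x^-1)^-1.
  by rewrite mulKVg invMg invgK.
exact/Ssigma/S_inv/S_conj.
Qed.

End Twisted.

(** The untwisted graphs are the case sigma = 1, so the twisted lemmas ask only for an involutive
    [sigma]. *)
Lemma admissible_graph_cop_number_le (Gamma : rel gT) :
  admissible_graph S Gamma -> ((cop_number Gamma)%:R <= bound)%R.
Proof.
have symP : symmetric_set S -> forall s, s \in S -> s^-1 \in S.
  by move=> symS s Ss; rewrite symS inE invgK.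
have A1 : 1 \in Aut [set: gT] by exact: group1.
have K1 : involutive (1 : {perm gT}) by move=> x; rewrite !perm1.
have orderK sigma : automorphism_of_order_two sigma -> involutive sigma.
  by case=> _ o2 x; rewrite -permM -[_ * _]/(sigma ^+ 2) -o2 expg_order perm1.
case=> [S_conj uc|symS uc|sigma symS S_conj As uc|sigma symS As uc].
- have cE : cayley S = twisted_cayley 1 S.
    by apply/funext => x; apply/funext => y; apply: eq_existsb => s; rewrite perm1.
  (* Here S is symmetric by undirectedness: the edge from 1 to s has a reverse. *)
  rewrite cE in uc *; apply: twisted_cayley_cop_number_le => // s Ss.
  have [sym _] := uc.
  have : twisted_cayley 1 S 1 s.
    by apply/exists_inP; exists s; rewrite // perm1 mul1g.
  rewrite sym => /exists_inP[t St]; rewrite perm1 eq_sym -eq_invg_mul.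
  by move=> /eqP->.
- have cE : cayley_sum S = twisted_cayley_sum 1 S.
    by apply/funext => x; apply/funext => y; apply: eq_existsb => s; rewrite perm1.
  rewrite cE in uc *; apply: twisted_cayley_sum_cop_number_le => //.
  exact: symP.
- apply: twisted_cayley_cop_number_le => //; last exact: symP.
    by case: As.
  exact: orderK.
- apply: twisted_cayley_sum_cop_number_le => //; last exact: symP.
    by case: As.
  exact: orderK.
Qed.

End AdmissibleGraphs.

(** The trivial group is excluded from the explicit bound: log 1 = 0, yet one cop is needed. *)
Theorem theorem1p4 (R : realType) :
  [/\ forall (gT : finGroupType) (S : {set gT}) (Gamma : rel gT),
        (1 < #|gT|)%N -> admissible_graph S Gamma ->
        (cop_number Gamma)%:R <= 2 * Num.sqrt #|gT|%:R * ln #|gT|%:R :> R,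
      forall c : R, c < 2^-1 -> cop_number_bigO admissible_family (1 - c)
    & weak_meyniel R admissible_family].
Proof.
have bigO (c : R) : c < 2^-1 -> cop_number_bigO admissible_family (1 - c).
  (* The summand 1 covers the trivial group. *)
  move=> c_lt; exists (2 / (2^-1 - c) + 1) => gT Gamma [S adm].
  have C_ge0 : 0 <= 2 / (2^-1 - c) by rewrite divr_ge0 // subr_ge0 ltW.
  have n_gt0 : (0 < #|gT|)%N by apply/card_gt0P; exists 1%g.
  have [n_gt1|n_le1] := ltnP 1 #|gT|.
    apply: le_trans (admissible_graph_cop_number_le R n_gt1 adm) _.
    apply: le_trans (sqrt_ln_le_powR c_lt n_gt0) _.
    by rewrite ler_wpM2r ?powR_ge0 // lerDl.
  have n1 : #|gT| = 1%N by apply/eqP; rewrite eqn_leq n_le1.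
  rewrite n1 powR1 mulr1; apply: (@le_trans _ _ 1); last by rewrite lerDr.
  by rewrite (ler_nat R _ 1) -n1 cop_number_le_card.
split=> // [gT S Gamma n_gt1 adm|].
  exact: (admissible_graph_cop_number_le R n_gt1 adm).
by exists 4^-1; [lra | apply: bigO; lra].
Qed.
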